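(* Let $D$ be an arc-locally in-semicomplete digraph. If $D$ does not contain an anti-directed odd cycle as an induced subdigraph, then $D$ is $\alpha$-diperfect.
   Context: All digraphs are finite, without loops and without multiple edges (a pair of opposite edges $uv$, $vu$ is allowed). Two vertices $u,v$ are adjacent if $uv$ or $vu$ is an edge. The underlying graph $U(D)$ is the simple graph on $V(D)$ in which two vertices are joined exactly when they are adjacent in $D$. A source is a vertex with no in-neighbor, a sink is a vertex with no out-neighbor. A digraph $D$ is arc-locally in-semicomplete if for each edge $uv\in E(D)$, every in-neighbor of $u$ and every in-neighbor of $v$ are adjacent or are the same vertex. A digraph $C$ is an anti-directed odd cycle if $U(C)=x_1x_2\dots x_{2k+1}x_1$ is a cycle for some $k\ge 2$, and each of the vertices $x_1,x_2,x_3,x_4,x_6,x_8,\ldots,x_{2k}$ is either a source or a sink of $C$. A stable set is a set of pairwise non-adjacent vertices. A path is a directed path with distinct vertices (a single vertex is a path). A path partition of $D$ is a collection $\mathcal{P}$ of paths of $D$ such that every vertex of $D$ belongs to exactly one path of $\mathcal{P}$. For a stable set $S$ of $D$, an $S$-path partition of $D$ is a path partition $\mathcal{P}$ such that $|V(P)\cap S|=1$ for every $P\in\mathcal{P}$. A digraph satisfies the $\alpha$-property if for every maximum (i.e. maximum cardinality) stable set $S$ it has an $S$-path partition. A digraph is $\alpha$-diperfect if every one of its induced subdigraphs satisfies the $\alpha$-property. *)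

(* Defs.v *)
From mathcomp Require Import all_boot.

Set Implicit Arguments.
Unset Strict Implicit.
Unset Printing Implicit Defensive.

Record digraph := Digraph {
  vertex :> finType;
  edge : rel vertex;
  edge_irrefl : irreflexive edge
}.

(* As digraphs are loopless, this is also the edge relation of the underlying
   simple graph U(D). *)
Definition adjacent (D : digraph) : rel D :=
  fun u v => edge u v || edge v u.

Definition source (D : digraph) (v : D) : bool := [forall u : D, ~~ edge u v].
Definition sink (D : digraph) (v : D) : bool := [forall u : D, ~~ edge v u].

Definition induced_edge (D : digraph) (A : {set D}) : rel {x : D | x \in A} :=
  fun u v => edge (val u) (val v).

Lemma induced_edge_irrefl (D : digraph) (A : {set D}) :
  irreflexive (@induced_edge D A).
Proof. by move=> u; apply: edge_irrefl. Qed.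

Definition induced (D : digraph) (A : {set D}) : digraph :=
  Digraph (@induced_edge_irrefl D A).

Definition arc_locally_in_semicomplete (D : digraph) : Prop :=
  forall u v : D, edge u v ->
  forall x y : D, edge x u -> edge y v -> adjacent x y \/ x = y.

(* The indices are shifted by one: [x i] is the vertex x_(i+1), so the
   required sources or sinks x_1, x_3 and x_2, x_4, ..., x_(2k) have indices
   0, 2 and the odd numbers. [ordS] is the cyclic successor on 'I_n. *)
Definition antidirected_odd_cycle (C : digraph) : Prop :=
  exists (k : nat) (x : 'I_(k.*2.+1) -> C),
    [/\ 2 <= k,
        bijective x,
        forall i j, adjacent (x i) (x j) = (j == ordS i) || (i == ordS j)
      & forall i : 'I_(k.*2.+1), (i == 0 :> nat) || (i == 2 :> nat) || odd i ->
          source (x i) || sink (x i)].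

Definition stable (D : digraph) (S : {set D}) : Prop :=
  {in S &, forall u v, ~~ adjacent u v}.

Definition maximum_stable (D : digraph) (S : {set D}) : Prop :=
  stable S /\ forall S' : {set D}, stable S' -> #|S'| <= #|S|.

Definition dipath (D : digraph) (p : seq D) : bool :=
  [&& p != [::], uniq p & sorted (@edge D) p].

(* Paths being nonempty, the condition on [count] also excludes repeated
   members, so the list [P] is a faithful encoding of a set of paths. *)
Definition path_partition (D : digraph) (P : seq (seq D)) : Prop :=
  {in P, forall p, dipath p} /\
  forall v : D, count (fun p : seq D => v \in p) P = 1.

Definition S_path_partition (D : digraph) (S : {set D}) (P : seq (seq D)) :
    Prop :=
  path_partition P /\ {in P, forall p : seq D, #|[set v in p] :&: S| = 1}.

Definition alpha_property (D : digraph) : Prop :=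
  forall S : {set D}, maximum_stable S ->
  exists P : seq (seq D), S_path_partition S P.

Definition alpha_diperfect (D : digraph) : Prop :=
  forall A : {set D}, alpha_property (induced A).

(* Main.v *)
(* Let D[Y] be a vertex-minimal counterexample for a maximum stable set S, and
   put T = Y \ S.  Removing vertices of T leaves an S-path partition into which they
   cannot be inserted, and this forces the following.
   - Out-neighbourhoods of vertices of T are stable: otherwise v fits into the
     path that first meets the non-sinks of D[N+(v)].
   - If v is left out, it can be exchanged with other vertices of T that have a
     common out-neighbour with it.  The set W of all possible leftover vertices
     is stable and |N+(W) /\ S| < |W| <= |N(W) /\ S|, so some s in S
     dominates v.
   - An edge in D[T] therefore has a unique S-vertex s dominating both ends.  If
     a in T has s as its only in-neighbour, then W, s and the paths meeting W
     split off from D.  Otherwise every tail of an edge of D[T] has an in-neighbour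
     in T, so there is a directed cycle in D[T] whose only in-neighbour outside
     it is s; it has no out-neighbours outside it, as otherwise the whole cycle could be
     inserted, and so it splits off together with s.
   - Hence T is stable, D[Y] is bipartite, and Hall's argument applies. *)
Require Import Defs.
From mathcomp Require Import all_boot.
From mathcomp Require Import boolp zify.

Set Implicit Arguments.
Unset Strict Implicit.
Unset Printing Implicit Defensive.

(** * Counting and iteration on finite types *)

Lemma count_eq1_uniq (T : eqType) (a : pred T) (s : seq T) (x : T) :
  uniq s -> {in s, forall y, a y = (y == x)} -> x \in s -> count a s = 1.
Proof.
move=> s_uniq a_eq xs.
by rewrite (eq_in_count (a2 := pred1 x)) ?count_uniq_mem ?xs.
Qed.

Lemma has_first (T : Type) (a : pred T) (s : seq T) :
  has a s -> exists s1 x s2, [/\ s = s1 ++ x :: s2, a x & ~~ has a s1].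
Proof.
case/split_find => x s1 s2 ax s1a.
by exists s1, x, s2; rewrite cat_rcons.
Qed.

(** An injective map on a finite type is a permutation, so iterating [h] from [x = h y] comes back
    to [y]. *)
Lemma iter_closed_inj (T : finType) (h : T -> T) (P : T -> Prop) x y :
  injective h -> (forall z, P z -> P (h z)) -> h y = x -> P x -> P y.
Proof.
move=> h_inj hP hy Px.
have: fconnect h x y by rewrite fconnect_sym // -hy fconnect1.
move=> /iter_findex <-.
by elim: (findex _ _ _) => //= n /hP.
Qed.

(** * Surgery on S-path partitions *)

Section Orthogonal.
Variable D : digraph.
Implicit Types (x y z : D) (S Y X W : {set D}) (f : D -> seq D).

Lemma adjacentC x y : adjacent x y = adjacent y x.
Proof. by rewrite /adjacent orbC. Qed.

Lemma adjacent_irr x : adjacent x x = false.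
Proof. by rewrite /adjacent edge_irrefl. Qed.

Lemma edge_adjacent x y : edge x y -> adjacent x y.
Proof. by rewrite /adjacent => ->. Qed.

Lemma edge_neq x y : edge x y -> x != y.
Proof. by apply: contraTneq => ->; rewrite edge_irrefl. Qed.

(** Subsets of one fixed vertex type stand for induced subdigraphs, so that the induction on [Y]
    never changes the type. *)
Record max_stable_in Y S : Prop := MaxStableIn {
  max_stable_sub : S \subset Y;
  max_stable_stable : stable S;
  max_stable_card : forall Z : {set D}, Z \subset Y -> stable Z -> #|Z| <= #|S|
}.

(* An S-path partition of D[Y], encoded by the map sending each s in S to the
   path through s; the values of f outside S are irrelevant. *)
Record orthogonal S Y f : Prop := Orthogonal {
  orth_uniq : {in S, forall s, uniq (f s)};
  orth_sorted : {in S, forall s, sorted (@edge D) (f s)};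
  orth_mem : {in S &, forall s t, (t \in f s) = (t == s)};
  orth_sub : {in S, forall s, {subset f s <= Y}};
  orth_cover : {in Y, forall y, exists2 s, s \in S & y \in f s};
  orth_disj : {in S &, forall s t y, y \in f s -> y \in f t -> s = t}
}.

Definition update f s p := fun t : D => if t == s then p else f t.

(** Common core of insertion and exchange: by the last hypothesis the vertices new to the path of
    [s] lie outside [Y], hence on no other path. *)
Lemma orth_update S Y Y' f s p :
  orthogonal S Y f -> s \in S -> uniq p -> sorted (@edge D) p ->
  {in S, forall t, (t \in p) = (t == s)} ->
  (forall y, (y \in Y') = (y \in p) || (y \in Y) && (y \notin f s)) ->
  (forall y, y \in p -> y \in f s \/ y \notin Y) ->
  orthogonal S Y' (update f s p).
Proof.
move=> [f_uniq f_sorted f_mem f_sub f_cover f_disj] sS p_uniq p_sorted p_mem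
  Y'E p_old.
have p_other t y : t \in S -> t != s -> y \in p -> y \notin f t.
  move=> tS ts /p_old [] yfs; apply/negP => yft; last by rewrite (f_sub t) in yfs.
  by rewrite (f_disj _ _ tS sS y) ?eqxx in ts.
split=> [t tS|t tS|t u tS uS|t tS y|y|t u tS uS y]; rewrite /update.
- by case: eqP => _ //; apply: f_uniq.
- by case: eqP => _ //; apply: f_sorted.
- by case: eqP => [->|_]; [apply: p_mem | apply: f_mem].
- case: eqVneq => [_ yp|ts yft]; rewrite Y'E; first by rewrite yp.
  rewrite (f_sub t) //=; case: (boolP (y \in f s)) => [yfs|_]; last by rewrite orbT.
  by rewrite (f_disj _ _ tS sS y) ?eqxx in ts.
- rewrite Y'E => /orP [yp|/andP [/f_cover [t tS yt] yfs]].
    by exists s => //; rewrite eqxx.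
  by exists t => //; case: eqP => // ts; rewrite ts (negPf yfs) in yt.
case: (eqVneq t s) => [->|ts]; case: (eqVneq u s) => [->|us] //.
- by move=> yp; rewrite (negPf (p_other u y uS us yp)).
- by move=> yt yp; rewrite (negPf (p_other t y tS ts yp)) in yt.
exact: f_disj.
Qed.

Lemma orth_insert S Y f s p c q :
  orthogonal S (Y :\: [set x in c]) f -> s \in S -> f s = p ++ q ->
  uniq c -> {subset c <= Y :\: S} -> sorted (@edge D) (p ++ c ++ q) ->
  orthogonal S Y (update f s (p ++ c ++ q)).
Proof.
move=> orth sS fs c_uniq cT pcq_sorted.
have c_old x : x \in c -> x \notin f s.
  by move=> xc; apply/negP => /(orth_sub orth sS); rewrite !inE xc.
have pcqE : p ++ c ++ q =i c ++ f s.
  by move=> x; rewrite fs !mem_cat orbCA.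
apply: (orth_update orth) => // [|t tS|y|y].
- rewrite (perm_uniq (_ : perm_eq _ (c ++ (p ++ q)))); last first.
    by rewrite perm_catCA.
  rewrite -fs cat_uniq c_uniq (orth_uniq orth) // andbT /=.
  by apply/hasPn => x xfs; apply: contraL xfs => /c_old.
- rewrite pcqE mem_cat (orth_mem orth) //.
  by case: (boolP (t \in c)) => // /cT; rewrite inE tS.
- rewrite pcqE mem_cat !inE.
  case: (boolP (y \in c)) => [/cT|_] /=; first by case/setDP.
  case: (boolP (y \in f s)) => [/(orth_sub orth sS)|_]; last by rewrite andbT.
  by case/setDP.
rewrite pcqE mem_cat => /orP [yc|]; last by left.
by right; rewrite !inE yc.
Qed.

Lemma orth_exchange S Y f v x s p q :
  orthogonal S (Y :\ v) f -> v \in Y :\: S -> s \in S -> f s = p ++ x :: q ->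
  x \notin S -> sorted (@edge D) (p ++ v :: q) ->
  orthogonal S (Y :\ x) (update f s (p ++ v :: q)).
Proof.
move=> orth /setDP [vY vS] sS fs xS pvq_sorted.
have vfs : v \notin f s.
  by apply/negP => /(orth_sub orth sS); rewrite !inE eqxx.
have xfs : x \in f s by rewrite fs mem_cat inE eqxx orbT.
have xv : x != v by apply: contraNneq vfs => <-.
have pvqE : p ++ v :: q =i v :: (p ++ q).
  by move=> y; rewrite inE !mem_cat inE orbCA.
have fsE : f s =i x :: (p ++ q).
  by move=> y; rewrite inE fs !mem_cat inE orbCA.
have := orth_uniq orth sS.
rewrite fs (perm_uniq (_ : perm_eq _ (x :: (p ++ q)))); last first.
  by rewrite -cat1s perm_catCA.
move=> /= /andP [xpq pq_uniq].
apply: (orth_update orth) => // [|t tS|y|y].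
- rewrite (perm_uniq (_ : perm_eq _ (v :: (p ++ q)))); last first.
    by rewrite -cat1s perm_catCA.
  by rewrite /= pq_uniq andbT; move: vfs; rewrite fsE inE negb_or => /andP [].
- have /negPf tv : t != v by apply: contraNneq vS => <-.
  have /negPf tx : t != x by apply: contraNneq xS => <-.
  by have := orth_mem orth sS tS; rewrite fsE pvqE !inE tv tx.
- rewrite pvqE fsE !inE.
  case: (eqVneq y v) => [->|yv] /=; first by rewrite eq_sym xv.
  case: (eqVneq y x) => [->|yx] /=; first by rewrite andbF orbF (negPf xpq).
  case: (boolP (y \in p ++ q)) => [ypq|_]; last by rewrite andbT.
  have : y \in f s by rewrite fsE inE ypq orbT.
  by move=> /(orth_sub orth sS); rewrite !inE => /andP [].
rewrite pvqE fsE !inE => /orP [/eqP ->|->]; last by left; rewrite orbT.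
by right; rewrite eqxx.
Qed.

Lemma orth_union S Y X f g :
  X \subset Y -> S \subset Y ->
  orthogonal (S :&: X) X f -> orthogonal (S :\: X) (Y :\: X) g ->
  orthogonal S Y (fun s => if s \in X then f s else g s).
Proof.
move=> /subsetP XY /subsetP SY orthf orthg.
have inf s : s \in S -> s \in X -> s \in S :&: X by move=> *; apply/setIP.
have ing s : s \in S -> s \notin X -> s \in S :\: X by move=> *; apply/setDP.
have fX s y : s \in S -> s \in X -> y \in f s -> y \in X.
  by move=> sS sX; apply: (orth_sub orthf); apply: inf.
have gX s y : s \in S -> s \notin X -> y \in g s -> y \notin X.
  by move=> sS sX /(orth_sub orthg (ing _ sS sX)) /setDP [].
split=> [s sS|s sS|s t sS tS|s sS y|y yY|s t sS tS y].
- case: ifPn => sX; first exact: (orth_uniq orthf (inf _ sS sX)).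
  exact: (orth_uniq orthg (ing _ sS sX)).
- case: ifPn => sX; first exact: (orth_sorted orthf (inf _ sS sX)).
  exact: (orth_sorted orthg (ing _ sS sX)).
- case: ifPn => sX; case: (boolP (t \in X)) => tX.
  + by rewrite (orth_mem orthf) ?inf.
  + rewrite (negPf (_ : t != s)); last by apply: contraNneq tX => ->.
    by apply: contraNF tX; apply: fX.
  + rewrite (negPf (_ : t != s)); last by apply: contraNneq sX => <-.
    by apply: contraTF tX; apply: gX.
  + by rewrite (orth_mem orthg) ?ing.
- case: ifPn => sX; first by move=> /fX -/(_ sS sX) /XY.
  by move=> /(orth_sub orthg (ing _ sS sX)) /setDP [].
- case: (boolP (y \in X)) => yX.
    have [s /setIP [sS sX] ys] := orth_cover orthf yX.
    by exists s; rewrite ?sX.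
  have [s /setDP [sS sX] ys] : exists2 s, s \in S :\: X & y \in g s.
    by apply: (orth_cover orthg); apply/setDP.
  by exists s; rewrite ?(negPf sX).
case: ifPn => sX; case: ifPn => tX.
- exact: (orth_disj orthf (inf _ sS sX) (inf _ tS tX)).
- by move=> /(fX _ _ sS sX) yX /(gX _ _ tS tX); rewrite yX.
- by move=> /(gX _ _ sS sX) yX /(fX _ _ tS tX); rewrite (negPf yX).
- exact: (orth_disj orthg (ing _ sS sX) (ing _ tS tX)).
Qed.

(** * Stable sets and their neighbours in [S] *)

Lemma stableU S W :
  stable S -> stable W ->
  (forall w s, w \in W -> s \in S -> ~~ adjacent w s) -> stable (S :|: W).
Proof.
move=> S_stable W_stable WS x y /setUP [xS|xW] /setUP [yS|yW].
- exact: S_stable.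
- by rewrite adjacentC; apply: WS.
- exact: WS.
- exact: W_stable.
Qed.

Lemma stable_subset S W : W \subset S -> stable S -> stable W.
Proof. by move=> /subsetP WS S_stable x y /WS xS /WS yS; apply: S_stable. Qed.

Definition nbrs S W := [set s in S | [exists w in W, adjacent w s]].

Lemma nbrsP S W s :
  reflect (s \in S /\ exists2 w, w \in W & adjacent w s) (s \in nbrs S W).
Proof.
rewrite inE; apply: (iffP andP) => -[sS].
  by case/exists_inP => w wW ws; split => //; exists w.
by case=> w wW ws; split => //; apply/exists_inP; exists w.
Qed.

(** Replacing the neighbours of [W] in [S] by [W] gives a stable set, which cannot be larger than
    [S]. *)
Lemma card_nbrs Y S W :
  max_stable_in Y S -> W \subset Y :\: S -> stable W -> #|W| <= #|nbrs S W|.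
Proof.
move=> [SY S_stable S_max] WT W_stable.
have NS : nbrs S W \subset S by apply/subsetP => s /nbrsP [].
have : #|(S :\: nbrs S W) :|: W| <= #|S|.
  apply: S_max.
    rewrite subUset (subset_trans (subsetDl _ _) SY).
    by rewrite (subset_trans WT (subsetDl _ _)).
  apply: stableU W_stable _.
    exact: stable_subset (subsetDl _ _) S_stable.
  move=> w s wW /setDP [sS sN]; apply/negP => ws.
  by case/negP: sN; apply/nbrsP; split => //; exists w.
rewrite cardsU (_ : _ :&: W = set0) ?cards0 ?subn0; last first.
  apply/setP => x; rewrite !inE; apply/negP => /andP [/andP [_ xS]].
  by move/(subsetP WT)/setDP => -[_]; rewrite xS.
by rewrite cardsD (setIidPr NS) -{2}(subnK (subset_leq_card NS)) leq_add2l.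
Qed.

(* Any stable set disjoint from X can be enlarged by W, so S stays maximum
   outside X. *)
Lemma max_stable_split Y S X W :
  max_stable_in Y S -> W \subset X -> X \subset Y -> stable W ->
  (forall w y, w \in W -> y \in Y -> adjacent w y -> y \in X) ->
  #|S :&: X| <= #|W| -> max_stable_in (Y :\: X) (S :\: X).
Proof.
move=> [SY S_stable S_max] WX XY W_stable WN cardW.
split; first exact: setSD.
  exact: stable_subset (subsetDl _ _) S_stable.
move=> Z ZYX Z_stable.
have : #|Z :|: W| <= #|S|.
  apply: S_max.
    rewrite subUset (subset_trans ZYX (subsetDl _ _)).
    exact: subset_trans WX XY.
  apply: stableU => // w z wW /(subsetP ZYX) /setDP [zY zX].
  by apply: contra zX; apply: WN.
rewrite cardsU (_ : Z :&: W = set0) ?cards0 ?subn0; last first.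
  apply/setP => x; rewrite !inE; apply/negP => /andP [/(subsetP ZYX)].
  by case/setDP => _ /negP xX /(subsetP WX).
rewrite -[X in _ <= X -> _](cardsID X S) addnC => le.
by rewrite -(leq_add2l #|W|) (leq_trans le) // leq_add2r.
Qed.

End Orthogonal.

(** * First consequences of minimality *)

Section MinimalCounterexample.
Variable D : digraph.
Hypothesis D_alis : arc_locally_in_semicomplete D.
Variables Y S : {set D}.
Hypothesis S_max : max_stable_in Y S.
Hypothesis IH : forall Y' S' : {set D}, #|Y'| < #|Y| -> max_stable_in Y' S' ->
  exists f, orthogonal S' Y' f.
Hypothesis no_orth : forall f, ~ orthogonal S Y f.
Implicit Types (x y z t w : D) (p q c : seq D) (f g : D -> seq D).

Let SY : {subset S <= Y} := subsetP (max_stable_sub S_max).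

Lemma alis x u v y :
  edge x u -> edge u v -> edge y v -> x != y -> edge x y \/ edge y x.
Proof.
move=> xu uv yv; case: (D_alis uv xu yv) => [/orP //|->].
by rewrite eqxx.
Qed.

Lemma S_nonadj s t : s \in S -> t \in S -> edge s t = false.
Proof.
move=> sS tS; apply/negP => st.
by have := max_stable_stable S_max sS tS; rewrite edge_adjacent.
Qed.

Lemma no_insert_block c f s p q :
  orthogonal S (Y :\: [set x in c]) f -> s \in S -> f s = p ++ q ->
  uniq c -> {subset c <= Y :\: S} -> ~ sorted (@edge D) (p ++ c ++ q).
Proof.
by move=> orth sS fs c_uniq cT pcq; apply: no_orth (orth_insert _ _ fs _ _ pcq).
Qed.

Lemma no_insert v f s p q :
  orthogonal S (Y :\ v) f -> v \in Y :\: S -> s \in S -> f s = p ++ q ->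
  ~ sorted (@edge D) (p ++ v :: q).
Proof.
move=> orth vT sS fs; apply: (@no_insert_block [:: v]) fs _ _ => //.
  rewrite (_ : [set x in [:: v]] = [set v]) //.
  by apply/setP => x; rewrite !inE.
by move=> x; rewrite inE => /eqP ->.
Qed.

Lemma orth_del (C : {set D}) :
  C \subset Y :\: S -> C != set0 -> exists f, orthogonal S (Y :\: C) f.
Proof.
move=> /subsetP CT C_n0; apply: IH.
  rewrite cardsD (setIidPr _); last by apply/subsetP => x /CT /setDP [].
  have [x xC] := set0Pn _ C_n0; have /CT /setDP [xY _] := xC.
  rewrite ltn_subrL card_gt0 C_n0 (cardD1 x) xY /=.
  by rewrite ltnS.
split=> [||Z ZYC].
- apply/subsetP => s sS; rewrite inE SY // andbT.
  by apply/negP => /CT; rewrite inE sS.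
- exact: max_stable_stable S_max.
by apply: (max_stable_card S_max); apply: subset_trans ZYC (subsetDl _ _).
Qed.

Lemma orth_del1 v : v \in Y :\: S -> exists f, orthogonal S (Y :\ v) f.
Proof.
by move=> vT; apply: orth_del; rewrite ?sub1set //; apply/set0Pn; exists v; rewrite inE.
Qed.

Lemma out_stable v x x' :
  v \in Y :\: S -> x \in Y -> x' \in Y -> edge v x -> edge v x' ->
  edge x x' = false.
Proof.
move=> vT xY x'Y vx vx'; apply/negP => xx'.
have [f orth] := orth_del1 vT.
pose A := [pred u in Y | edge v u & [exists u' in Y, edge v u' && edge u u']].
have xA : x \in A.
  by rewrite !inE xY vx /=; apply/exists_inP; exists x' => //; rewrite vx'.
have [|s sS xs] := orth_cover orth (_ : x \in _).
  by rewrite !inE xY eq_sym edge_neq.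
have /has_first [s1 [z [s2 [fsE zA /hasPn s1A]]]] : has (mem A) (f s).
  by apply/hasP; exists x.
have := orth_sorted orth sS; have ninsert := no_insert orth vT sS.
have fsub := orth_sub orth sS; rewrite {}fsE in ninsert fsub *.
have /and3P [zY vz /exists_inP [z' z'Y /andP [vz' zz']]] := zA.
case/lastP: s1 s1A fsub ninsert => [|s1 y] s1A fsub ninsert.
  move=> fs_sorted; apply: (ninsert [::] (z :: s2) erefl).
  by rewrite /= vz.
rewrite cat_rcons in ninsert fsub *.
rewrite sorted_cat_cons => /andP [s1_sorted /= /andP [yz zs2]].
have [yY yv] : y \in Y /\ y != v.
  have := fsub y; rewrite mem_cat !inE eqxx orbT => /(_ isT).
  by case/andP.
(* Here y -> z -> z' <- v. An edge y -> v would allow inserting [v] before [z]; an edge v -> y would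
   put [y] into [A], although [z] is the first vertex of [A] on the path. *)
case: (alis yz zz' vz' yv) => [yev|vy].
  apply: (ninsert (rcons s1 y) (z :: s2)); first by rewrite cat_rcons.
  by rewrite cat_rcons sorted_cat_cons s1_sorted /= yev vz.
have := s1A y; rewrite mem_rcons !inE eqxx => /(_ isT) /negP; case.
by rewrite yY vy /=; apply/exists_inP; exists z => //; rewrite vz.
Qed.

(** * Siblings: vertices with a common out-neighbour *)

Definition siblings : rel D := fun t t' =>
  [&& t \in Y :\: S, t' \in Y :\: S & [exists z in Y, edge t z && edge t' z]].

Lemma siblings_sym : symmetric siblings.
Proof.
move=> t t'; rewrite /siblings andbCA; congr [&& _, _ & _].
by apply: eq_existsb => z; rewrite [edge t z && _]andbC.
Qed.

(** Induction on the length of a chain of siblings from [t] to [t1]. If t -> t1, let [z] be a common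
    out-neighbour of [t1] and the vertex l before it in the chain. Then t -> t1 -> z <- l makes [t]
    and l adjacent, against the shorter chain, unless t = l, which contradicts [out_stable]. The
    case t1 -> t is symmetric. *)
Lemma siblings_nonadj t t' :
  connect siblings t t' -> adjacent t t' = false.
Proof.
case/connectP => p p_path ->; have [n] := ubnP (size p).
elim: n t p p_path => // n IHn t p.
case/lastP: p => [|p t1]; first by rewrite adjacent_irr.
move=> p_path; rewrite size_rcons ltnS last_rcons => size_p; apply/negP => /orP [tt1|t1t].
  move: p_path; rewrite rcons_path => /andP [p_path].
  case/and3P => lT t1T /exists_inP [z zY /andP [lz t1z]].
  have := IHn _ _ p_path size_p.
  case: (eqVneq t (last t p)) => [tl _|tl].
    have /setDP [t1Y _] := t1T; rewrite -tl in lT lz.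
    by rewrite (out_stable lT t1Y zY tt1 lz) in t1z.
  by move/negP; apply; apply/orP; apply: alis tt1 t1z lz tl.
case: p p_path size_p => [|t2 p] /=.
  rewrite andbT => /and3P [tT t1T /exists_inP [z zY /andP [tz t1z]]] _.
  have /setDP [tY _] := tT.
  by rewrite (out_stable t1T tY zY t1t t1z) in tz.
case/andP => /and3P [tT t2T /exists_inP [z zY /andP [tz t2z]]] p_path size_p.
have := IHn _ _ p_path; rewrite size_rcons last_rcons => /(_ size_p).
case: (eqVneq t1 t2) => [t12 _|t12].
  have /setDP [tY _] := tT; rewrite -t12 in t2T t2z.
  by rewrite (out_stable t2T tY zY t1t t2z) in tz.
rewrite adjacentC; move/negP; apply; apply/orP.
exact: alis t1t tz t2z t12.
Qed.

(** Search backwards from [z] along y -> x -> z <- v: an edge y -> v lets [v] replace [x], and v ->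
    y restarts the search two places earlier. [v] never dominates the first vertex of the path, as
    it could be inserted before it. *)
Lemma exchange_position v f s p z q :
  orthogonal S (Y :\ v) f -> v \in Y :\: S -> s \in S -> f s = p ++ z :: q ->
  edge v z -> exists p' x z' q',
    [/\ f s = p' ++ x :: z' :: q', edge v z',
        exists r, z' :: q' = r ++ z :: q &
        sorted (@edge D) (p' ++ v :: z' :: q')].
Proof.
move=> orth vT sS; have ninsert := no_insert orth vT sS.
have vf : v \notin f s.
  by apply/negP => /(orth_sub orth sS); rewrite !inE eqxx.
have fs_sorted := orth_sorted orth sS.
have [n] := ubnP (size p).
elim: n p z q => // n IHn p z q size_p fsE vz.
case/lastP: p size_p fsE => [|p x] size_p fsE.
  case: (ninsert [::] _ fsE) => /=.
  by rewrite vz; move: fs_sorted; rewrite fsE.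
rewrite cat_rcons in fsE.
have := fs_sorted; rewrite fsE sorted_cat_cons => /andP [p_sorted /= /andP [xz zq]].
case/lastP: p p_sorted size_p fsE => [|p y] p_sorted size_p fsE.
  by exists [::], x, z, q; split=> //=; [exists [::] | rewrite vz].
have yv : y != v.
  by apply: contraNneq vf => <-; rewrite fsE mem_cat mem_rcons inE eqxx.
have yx : edge y x.
  by move: p_sorted; rewrite -cats1 cat_rcons sorted_cat_cons /= => /and3P [].
case: (alis yx xz vz yv) => [yev|vy].
  exists (rcons p y), x, z, q; split=> //; first by exists [::].
  rewrite cat_rcons sorted_cat_cons /= yev vz zq !andbT.
  by move: p_sorted; rewrite -cats1 => /cat_sorted2 [].
have [||p' [x' [z' [q' [fsE' vz' [r rE] p'_sorted]]]]] := IHn p y (x :: z :: q) _ _ vy.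
- by move: size_p; rewrite !size_rcons ltnS => /ltnW.
- by rewrite fsE cat_rcons.
exists p', x', z', q'; split=> //; first by rewrite -fsE.
by exists (r ++ [:: y; x]); rewrite -catA.
Qed.

(** * Exchanging the left-out vertex *)

Section Exchange.
Variables (v0 : D) (f0 : D -> seq D).
Hypothesis v0T : v0 \in Y :\: S.
Hypothesis orth0 : orthogonal S (Y :\ v0) f0.

(** The left-out vertices and partitions reachable from [v0] and [f0], each step letting [w] replace
    the predecessor [x] of an out-neighbour of [w]. As [x] is outside [S], the path keeps its vertex
    of [S]. *)
Inductive exchanged : D -> (D -> seq D) -> Prop :=
| Exchanged0 : exchanged v0 f0
| ExchangedS w g s p x z q :
    exchanged w g -> s \in S -> g s = p ++ x :: z :: q -> edge w z ->
    sorted (@edge D) (p ++ w :: z :: q) -> x \notin S ->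
    exchanged x (update g s (p ++ w :: z :: q)).

Definition leftover : {set D} := [set w | `[< exists g, exchanged w g >]].

Lemma leftoverP w : reflect (exists g, exchanged w g) (w \in leftover).
Proof. by rewrite inE; apply: asboolP. Qed.

Lemma exchanged_orth w g :
  exchanged w g -> w \in Y :\: S /\ orthogonal S (Y :\ w) g.
Proof.
elim=> // {}w {}g s p x z q _ [wT orth] sS gsE wz p_sorted xS; split.
  rewrite inE xS; have gsub := orth_sub orth sS; have := gsub x.
  by rewrite gsE mem_cat inE eqxx orbT !inE => /(_ isT) /andP [].
exact: orth_exchange orth wT sS gsE xS p_sorted.
Qed.

Lemma leftover_sub : leftover \subset Y :\: S.
Proof. by apply/subsetP => w /leftoverP [g /exchanged_orth []]. Qed.

Lemma leftover0 : v0 \in leftover.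
Proof. by apply/leftoverP; exists f0; apply: Exchanged0. Qed.

(* Both ends of an exchange have a common out-neighbour, so a property that
   passes between siblings in [leftover] holds on all of it. *)
Lemma leftover_ind (P : D -> Prop) :
  P v0 ->
  (forall w x z, w \in leftover -> x \in leftover -> z \in Y ->
     edge w z -> edge x z -> P w -> P x) ->
  forall w, w \in leftover -> P w.
Proof.
move=> P0 PS w /leftoverP [g]; elim=> // {}w {}g s p x z q wg Pw sS gsE wz
  p_sorted xS.
have [wT orth] := exchanged_orth wg.
have xL : x \in leftover.
  by apply/leftoverP; eexists; apply: ExchangedS wg sS gsE wz p_sorted xS.
have zY : z \in Y.
  have gsub := orth_sub orth sS; have := gsub z.
  by rewrite gsE mem_cat !inE eqxx !orbT => /(_ isT) /andP [].
have xz : edge x z.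
  have := orth_sorted orth sS.
  by rewrite gsE sorted_cat_cons /= => /and3P [].
by apply: (PS w x z) => //; apply/leftoverP; exists g.
Qed.

(** Exchanged vertices are siblings, so any two members are joined by a chain of siblings. *)
Lemma leftover_stable : stable leftover.
Proof.
have conn w : w \in leftover -> connect siblings v0 w.
  move: w; apply: leftover_ind => [|w x z wL xL zY wz xz conn].
    exact: connect0.
  apply: connect_trans conn (connect1 _).
  rewrite /siblings !(subsetP leftover_sub) //=.
  by apply/exists_inP; exists z; rewrite ?wz.
move=> w x wL xL; apply/negbT/siblings_nonadj.
apply: connect_trans (conn _ xL).
by rewrite (sym_connect_sym siblings_sym) conn.
Qed.

(** An exchange that puts [w] on a path takes the leftover vertex [x] off it, so that path already
    met [leftover]. *)
Lemma exchanged_meets w g :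
  exchanged w g -> {in S, forall s x, x \in g s -> x \in leftover ->
    exists2 y, y \in f0 s & y \in leftover}.
Proof.
elim=> [s sS x xs xL|{}w {}g s p x z q wg IHg sS gsE wz p_sorted xS t tS y].
  by exists x.
rewrite /update; case: eqP => [->{t tS} _ _|_]; last exact: IHg.
apply: (IHg s sS x); first by rewrite gsE mem_cat inE eqxx orbT.
by apply/leftoverP; eexists; apply: ExchangedS wg sS gsE wz p_sorted xS.
Qed.

Lemma exchanged_fixed w g z :
  exchanged w g -> z \notin leftover -> {in S, forall s, (z \in g s) = (z \in f0 s)}.
Proof.
move=> wg zL; elim: wg => // {}w {}g s p x y q wg IHg sS gsE wy p_sorted xS t tS.
rewrite -IHg // /update; case: eqP => // ->.
have zx : z != x.
  apply: contraNneq zL => ->.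
  by apply/leftoverP; eexists; apply: ExchangedS wg sS gsE wy p_sorted xS.
have zw : z != w by apply: contraNneq zL => ->; apply/leftoverP; exists g.
by rewrite gsE !mem_cat !inE (negPf zx) (negPf zw).
Qed.

(** By [exchange_position], [w] can replace some [x] on the path of [z]. If [x] is outside [S], it
    is a leftover vertex. Otherwise x = s, so [z] comes after [s]; and an in-neighbour of [w] in [S]
    would be [s] itself, so that [w] could be inserted right after [s]. *)
Lemma leftover_out w z :
  w \in leftover -> z \in Y -> edge w z ->
  exists2 s, s \in S & z \in f0 s /\
    ((exists2 y, y \in f0 s & y \in leftover) \/
     [/\ z != s & forall u, u \in S -> edge u w -> False]).
Proof.
move=> wL zY wz; have /leftoverP [g wg] := wL.
have [wT orth] := exchanged_orth wg.
have zL : z \notin leftover.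
  apply/negP => zL; have := leftover_stable wL zL.
  by rewrite edge_adjacent.
have [s sS zs] : exists2 s, s \in S & z \in g s.
  by apply: (orth_cover orth); rewrite !inE zY eq_sym edge_neq.
exists s => //; split; first by rewrite -(exchanged_fixed wg).
have [p [q gsE]] : exists p q, g s = p ++ z :: q.
  by case/splitPr: zs => p q; exists p, q.
have [p' [x [z' [q' [gsE' wz' [r rE] p'_sorted]]]]] :=
  exchange_position orth wT sS gsE wz.
have xgs : x \in g s by rewrite gsE' mem_cat inE eqxx orbT.
case: (boolP (x \in S)) => xS; last first.
  left; apply: (exchanged_meets wg sS xgs).
  by apply/leftoverP; eexists; apply: ExchangedS wg sS gsE' wz' p'_sorted xS.
have xs : x = s by apply/eqP; rewrite -(orth_mem orth).
have := orth_uniq orth sS; have := orth_sorted orth sS.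
rewrite gsE' sorted_cat_cons => /andP [p'x_sorted /= /andP [xz' z'q']].
rewrite cat_uniq => /and3P [_ _] /= /andP [xq' _].
right; split=> [|u uS uw].
  by apply: contraNneq xq' => zs'; rewrite xs -zs' rE mem_cat inE eqxx orbT.
have ux : u = x.
  apply/eqP; case: (eqVneq u x) => // ux.
  by case: (alis uw wz' xz' ux); rewrite S_nonadj.
rewrite {}ux in uw.
apply: (no_insert orth wT sS (p := rcons p' x) (q := z' :: q')).
  by rewrite cat_rcons.
by rewrite cat_rcons sorted_cat_cons p'x_sorted /= uw wz'.
Qed.

Definition out_S := [set s in S | [exists w in leftover, edge w s]].

Lemma out_SP s :
  reflect (s \in S /\ exists2 w, w \in leftover & edge w s) (s \in out_S).
Proof.
rewrite inE; apply: (iffP andP) => -[sS].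
  by case/exists_inP => w wL ws; split => //; exists w.
by case=> w wL ws; split => //; apply/exists_inP; exists w.
Qed.

Lemma out_S_meets s :
  s \in out_S -> exists2 y, y \in f0 s & y \in leftover.
Proof.
case/out_SP => sS [w wL ws].
have [t tS [st [//|[st' _]]]] := leftover_out wL (SY sS) ws.
  by move: st; rewrite (orth_mem orth0) // => /eqP ->.
by move: st; rewrite (orth_mem orth0) // (negPf st').
Qed.

(** The default [s] is never taken on [out_S], by [out_S_meets]. *)
Definition meeting s := odflt s [pick y in leftover | y \in f0 s].

Lemma meetingP s : s \in out_S -> meeting s \in leftover :\ v0 /\ meeting s \in f0 s.
Proof.
move=> sO; have [y ys yL] := out_S_meets sO.
have /out_SP [sS _] := sO.
rewrite /meeting; case: pickP => [x /andP [xL xs]|/(_ y)]; last by rewrite yL ys.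
split=> //; rewrite in_setD1 xL andbT.
by have := orth_sub orth0 sS xs; rewrite !inE => /andP [].
Qed.

Lemma meeting_inj : {in out_S &, injective meeting}.
Proof.
move=> s t sO tO eq_st; have [_ xs] := meetingP sO; have [_ xt] := meetingP tO.
have /out_SP [sS _] := sO; have /out_SP [tS _] := tO.
by apply: (orth_disj orth0 sS tS xs); rewrite eq_st.
Qed.

Lemma meeting_sub : meeting @: out_S \subset leftover :\ v0.
Proof. by apply/subsetP => _ /imsetP [s /meetingP [] ? _ ->]. Qed.

(** [meeting] maps [out_S] injectively into [leftover] and misses [v0], which lies on no path of
    [f0]. *)
Lemma card_out_S : #|out_S| < #|leftover|.
Proof.
rewrite (cardsD1 v0 leftover) leftover0 ltnS -(card_in_imset meeting_inj).
exact: subset_leq_card meeting_sub.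
Qed.

(** From s -> w -> z <- x it follows that [s] and [x] are adjacent, and x -> s is excluded by the
    choice of [s]. So being dominated by [s] passes between siblings in [leftover]. *)
Lemma leftover_in_S s :
  s \in S -> s \notin out_S ->
  forall w, w \in leftover -> edge s w = edge s v0.
Proof.
move=> sS sO.
have sT w : w \in leftover -> s != w.
  by move/(subsetP leftover_sub); apply: contraTneq => <-; rewrite inE sS.
have noS w : w \in leftover -> edge w s = false.
  by move=> wL; apply: contraNF sO => ws; apply/out_SP; split => //; exists w.
apply: leftover_ind => // w x z wL xL zY wz xz <-; apply/idP/idP => sw.
  by case: (alis sw xz wz (sT w wL)) => //; rewrite noS.
by case: (alis sw wz xz (sT x xL)) => //; rewrite noS.
Qed.

Lemma nbrs_leftover s :
  s \in nbrs S leftover -> s \notin out_S -> edge s v0.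
Proof.
case/nbrsP => sS [w wL /orP [ws|sw]] sO; last by rewrite -(leftover_in_S _ _ wL).
by case/negP: sO; apply/out_SP; split => //; exists w.
Qed.

Lemma in_edge_leftover : exists s, [/\ s \in S, s \notin out_S & edge s v0].
Proof.
have := leq_trans card_out_S (card_nbrs S_max leftover_sub leftover_stable).
rewrite ltnNge; case: (boolP (nbrs S leftover \subset out_S)).
  by move=> /subset_leq_card ->.
case/subsetPn => s sN sO _; exists s; split=> //; last exact: nbrs_leftover.
by case/nbrsP: sN.
Qed.

End Exchange.

(** * Pieces of the digraph that split off *)

Lemma in_edge_S v : v \in Y :\: S -> exists2 s, s \in S & edge s v.
Proof.
move=> vT; have [f orth] := orth_del1 vT.
by have [s [sS _ sv]] := in_edge_leftover vT orth; exists s.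
Qed.

(** [W] has no neighbours in [Y :\: X], so [S :\: X] stays maximum there, and minimality gives a
    partition of the rest that can be glued to [f]. *)
Lemma split_absurd (X W : {set D}) f y :
  y \in X -> X \subset Y -> W \subset X -> stable W ->
  (forall w z, w \in W -> z \in Y -> adjacent w z -> z \in X) ->
  #|S :&: X| <= #|W| -> orthogonal (S :&: X) X f -> False.
Proof.
move=> yX XY WX W_stable WN cardW orthf.
have [|g orthg] := IH _ (max_stable_split S_max WX XY W_stable WN cardW).
  rewrite cardsD (setIidPr XY) ltn_subrL !card_gt0.
  by apply/andP; split; apply/set0Pn; exists y; rewrite ?(subsetP XY).
by apply: no_orth (orth_union XY _ orthf orthg); apply: max_stable_sub S_max.
Qed.

(* The leftover set W is tight here: the vertices of S adjacent to it are s and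
   those whose path contains a vertex of W other than a. *)
Lemma no_unique_in_edge a s :
  a \in Y :\: S -> s \in S -> ~ (forall y, y \in Y -> edge y a -> y = s).
Proof.
move=> aT sS a_in; have /setDP [aY aS] := aT.
have [f orth] := orth_del1 aT.
set W := leftover a f; set O := out_S a f.
have W_stable : stable W by apply: leftover_stable.
have [sO sa] : s \notin O /\ edge s a.
  have [t [tS tO ta]] := in_edge_leftover aT orth.
  by rewrite -(a_in t (SY tS) ta).
have OS : {subset O <= S} by move=> t /out_SP [].
have sW w : w \in W -> edge s w by move=> wW; rewrite (leftover_in_S aT orth sS sO).
(* A neighbour of [W] in [S] outside [O] dominates [a], so it is [s]. *)
have cardW : #|W| <= #|s |: O|.
  apply: leq_trans (card_nbrs S_max (leftover_sub aT orth) W_stable) _.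
  apply/subset_leq_card/subsetP => t tN; rewrite in_setU1.
  case: (boolP (t \in O)) => [|tO]; first by rewrite orbT.
  have /nbrsP [tS _] := tN.
  by rewrite (a_in t (SY tS)) ?eqxx //; apply: nbrs_leftover tN tO.
(* As |W| - 1 <= |O|, the injection [meeting] from [O] into [W :\ a] is onto. *)
have W_meets w : w \in W -> w != a -> exists2 t, t \in O & w \in f t.
  move=> wW wa; have : w \in meeting a f @: O.
    rewrite (_ : _ @: O = W :\ a) ?in_setD1 ?wa //.
    apply/eqP; rewrite eqEcard meeting_sub // (card_in_imset (meeting_inj _ _)) //.
    by move: cardW; rewrite cardsU1 sO (cardsD1 a W) leftover0.
  by case/imsetP => t tO ->; exists t => //; case: (meetingP aT orth tO).
pose X := s |: (a |: [set y | [exists t in O, y \in f t]]).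
have XP y : reflect ([\/ y = s, y = a | exists2 t, t \in O & y \in f t]) (y \in X).
  rewrite in_setU1 in_setU1 inE; apply: (iffP or3P).
    by case=> [/eqP|/eqP|/exists_inP]; [constructor 1|constructor 2|constructor 3].
  case=> [->|->|yO]; [constructor 1|constructor 2|constructor 3] => //.
  exact/exists_inP.
clearbody X.
have af t : t \in S -> a \notin f t.
  by move=> tS; apply/negP => /(orth_sub orth tS); rewrite !inE eqxx.
have SX t : t \in S :&: X -> t \in S /\ (t = s \/ t \in O).
  case/setIP => tS /XP [->|ta|[u uO tu]]; split=> //; first by left.
    by rewrite -ta tS in aS.
  by right; move: tu; rewrite (orth_mem orth (OS _ uO) tS) => /eqP ->.
have sX : s \in X by apply/XP; constructor 1.
(* In the inductive step y -> x -> z <- w makes [y] and [w] adjacent: y -> w is settled by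
   induction, and w -> y is the second alternative. *)
have W_in w y : w \in W -> y \in Y -> edge y w ->
    y = s \/ exists2 w', w' \in W & edge w' y.
  move=> wW; move: w wW y.
  apply: (leftover_ind aT orth) => [y yY ya|w x z wW xW zY wz xz wIH y yY yx].
    by left; apply: a_in.
  have yw : y != w.
    by apply: contraTneq yx => ->; have := W_stable _ _ wW xW; rewrite negb_or => /andP [].
  by case: (alis yx xz wz yw) => [/wIH|wy]; [apply | right; exists w].
(* The edge from [s] to [w] rules out the second alternative of [leftover_out]. *)
have W_out w y : w \in W -> y \in Y -> edge w y -> y \in X.
  move=> wW yY wy.
  have [t tS [yt [[x xt xW]|[_ /(_ s sS (sW w wW))]]]] //
    := leftover_out aT orth wW yY wy.
  have [|u uO xu] := W_meets x xW.
    by apply: contraNneq (af t tS) => <-.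
  apply/XP; constructor 3; exists u => //.
  by rewrite -(orth_disj orth tS (OS _ uO) xt xu).
(* The path of [s] is replaced by s -> a; the other vertices of [f s] stay outside [X]. *)
apply: (@split_absurd X W (fun t => if t == s then [:: s; a] else f t) s) => //.
- apply/subsetP => y /XP [->|->|[t tO yt]] //; first exact: SY.
  by have /setDP [] := orth_sub orth (OS _ tO) yt.
- apply/subsetP => w wW; apply/XP.
  by case: (eqVneq w a) => [|/(W_meets w wW)]; [constructor 2|constructor 3].
- move=> w y wW yY /orP [wy|yw]; first exact: W_out wy.
  by have [->|[w' w'W w'y]] := W_in w y wW yY yw; last exact: W_out w'y.
- apply: leq_trans (card_out_S aT orth).
  rewrite -add1n -(cards1 s); apply: leq_trans (leq_card_setU _ _).
  by apply/subset_leq_card/subsetP => t /SX [_ [->|tO]]; rewrite in_setU1 ?eqxx ?tO ?orbT.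
have sa_neq : s != a := edge_neq sa.
have O_neq t : t \in O -> (t == s) = false by apply: contraTF => /eqP ->.
split=> [t|t|t u|t|y|t u].
- case/SX => tS; case: eqP => [_ _|_ _]; first by rewrite /= inE sa_neq.
  exact: (orth_uniq orth).
- case/SX => tS; case: eqP => [_ _|_ _]; first by rewrite /= sa.
  exact: (orth_sorted orth).
- case/SX => tS _ /SX [uS _]; case: eqP => [->|_]; last exact: (orth_mem orth).
  by rewrite !inE (negPf (_ : u != a)) ?orbF //; apply: contraNneq aS => <-.
- case/SX => tS tO y; case: eqVneq tO => [_ _|ts [/eqP|tO yt]].
  + rewrite in_cons mem_seq1 => /orP [/eqP ->|/eqP ->] //.
    by apply/XP; constructor 2.
  + by rewrite (negPf ts).
  + by apply/XP; constructor 3; exists t.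
- case/XP => [->|->|[t tO yt]].
  + by exists s; rewrite ?eqxx ?inE ?sS ?sX ?eqxx.
  + by exists s; rewrite ?eqxx ?inE ?sS ?sX ?eqxx ?orbT.
  exists t; rewrite ?O_neq // in_setI OS //; apply/XP; constructor 3.
  by exists t => //; rewrite (orth_mem orth) ?eqxx ?OS.
case/SX => tS tO /SX [uS uO] y.
have f_not v : v \in S -> v = s \/ v \in O -> v != s -> y \in f v -> y \in [:: s; a] -> False.
  move=> vS _ vs yv; rewrite !inE => /orP [/eqP ys|/eqP ya].
    by move: yv; rewrite ys (orth_mem orth) // eq_sym (negPf vs).
  by have := af v vS; rewrite -ya yv.
case: eqVneq => [->|ts]; case: eqVneq => [->|us] //.
- by move=> y1 y2; case: (f_not u).
- by move=> y1 y2; case: (f_not t).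
exact: (orth_disj orth).
Qed.

(* If g -> u is the path edge entering N+(c) at a vertex u with y -> u for some
   y in c, then g dominates the predecessor of y, hence every second vertex
   going back along the cycle, and eventually the successor of y. *)
Lemma cycle_out c x z :
  uniq c -> cycle (@edge D) c -> {subset c <= Y :\: S} ->
  x \in c -> z \in Y -> edge x z -> z \in c.
Proof.
move=> c_uniq c_cycle cT xc zY xz; apply/negPn/negP => zc.
have [||f orth] := @orth_del [set y in c].
- by apply/subsetP => y; rewrite inE; apply: cT.
- by apply/set0Pn; exists x; rewrite inE.
have [s sS zs] : exists2 s, s \in S & z \in f s.
  by apply: (orth_cover orth); rewrite !inE zc.
have /has_first [s1 [u [s2 [fsE /hasP [y yc yu] /hasPn s1c]]]] :
  has (fun u : D => has (fun y : D => edge y u) c) (f s).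
  by apply/hasP; exists z => //; apply/hasP; exists x.
have [i c' c'E] := rot_to yc.
have c'c : y :: c' =i c by move=> v; rewrite -c'E mem_rot.
have c'_uniq : uniq (y :: c') by rewrite -c'E rot_uniq.
have c'_cycle : cycle (@edge D) (y :: c') by rewrite -c'E rot_cycle.
(* [d] is the cycle opened so that it starts at the successor of [y] and ends at [y]. As y -> u, it
   fits between [g] and [u] once [g] dominates its first vertex. *)
pose d := rcons c' y.
have dc : d =i c by move=> v; rewrite mem_rcons c'c.
have [v [d' [dE d_path d_last vE]]] : exists v d', [/\ d = v :: d',
    path (@edge D) v d', last v d' = y & v = next (y :: c') y].
  move: c'_cycle; rewrite /d /=; case: (c') => [|v c''] /=; rewrite eqxx.
    by exists y, [::].
  by case/andP => _ d_path; exists v, (rcons c'' y); rewrite last_rcons.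
have [] := no_insert_block (c := d) _ sS fsE.
- rewrite (_ : [set v in d] = [set v in c]) //.
  by apply/setP => w; rewrite !inE dc.
- by rewrite /d -rot1_cons rot_uniq.
- by move=> w; rewrite dc; apply: cT.
have := orth_sorted orth sS; rewrite fsE dE.
case/lastP: s1 fsE s1c => [|s1 g] fsE s1c.
  by rewrite /= cat_path d_path d_last /= yu.
rewrite !cat_rcons !sorted_cat_cons => /andP [-> /= /andP [gu us2]].
have gc w : w \in c -> edge w g = false.
  have /hasPn gc : ~~ has (fun y : D => edge y g) c.
    by apply: s1c; rewrite mem_rcons inE eqxx.
  by move/gc/negbTE.
rewrite cat_path d_path d_last /= yu us2 !andbT.
have g_neq w : w \in c -> w != g.
  move=> wc; apply: contraTneq wc => ->; apply/negP => gc'.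
  have := orth_sub orth sS; rewrite fsE => /(_ g).
  by rewrite mem_cat mem_rcons !inE eqxx gc' => /(_ isT).
(* [h] sends the successor of [y] to the predecessor of [y]. Being injective, it leads from the
   predecessor back to the successor by iteration, whatever the parity of the cycle length. *)
pose h w := prev (y :: c') (prev (y :: c') w).
have in_c' w : w \in c -> w \in y :: c' by rewrite c'c.
have prev_c w : w \in c -> prev (y :: c') w \in c by rewrite -!c'c mem_prev.
have edge_prev w : w \in c -> edge (prev (y :: c') w) w.
  by move/in_c'; apply: prev_cycle.
have h_inj : injective h.
  by apply: inj_comp; apply: can_inj (next_prev c'_uniq).
suff [] : v \in c /\ edge g v by [].
apply: (iter_closed_inj h_inj (P := fun w => w \in c /\ edge g w)
          (x := prev (y :: c') y)).
- move=> w [wc gw]; split; first exact/prev_c/prev_c.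
  have hw := edge_prev _ (prev_c _ wc).
  have hc := prev_c _ (prev_c _ wc).
  by case: (alis hw (edge_prev _ wc) gw (g_neq _ hc)) => //; rewrite gc.
- by rewrite /h vE prev_next.
split; first exact: prev_c.
by case: (alis (edge_prev _ yc) yu gu (g_neq _ (prev_c _ yc))) => //;
  rewrite gc // prev_c.
Qed.

(** * No edges inside [Y :\: S] *)

(** If u -> a -> b <- t with [u] and [t] in [S], then [u] and [t] are adjacent or equal, and [S] is
    stable. *)
Lemma edge_root a b :
  a \in Y :\: S -> b \in Y :\: S -> edge a b -> exists s,
    [/\ s \in S, edge s a, edge s b & forall u, u \in S -> edge u a || edge u b -> u = s].
Proof.
move=> aT bT ab.
have eq_S u t : u \in S -> t \in S -> edge u a -> edge t b -> u = t.
  move=> uS tS ua tb; apply/eqP; case: (eqVneq u t) => // ut.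
  by case: (alis ua ab tb ut); rewrite S_nonadj.
have [s sS sa] := in_edge_S aT; have [t tS tb] := in_edge_S bT.
have st := eq_S s t sS tS sa tb; exists s; split=> //; first by rewrite st.
move=> u uS /orP [ua|ub]; last by rewrite (eq_S s u).
by rewrite st; apply: eq_S.
Qed.

Lemma T_edgeless a b :
  a \in Y :\: S -> b \in Y :\: S -> edge a b = false.
Proof.
move=> aT bT; apply/negP => ab.
pose T := Y :\: S.
pose r := [rel x y : D | [&& x \in T, y \in T & edge x y]].
pose anc k := [set x | connect r x k].
pose tail := [pred k in T | [exists b in T, edge k b]].
have tail_a : tail a by rewrite /= aT; apply/exists_inP; exists b.
(* Let [k] be a tail with fewest ancestors in D[T]. A tail among its ancestors then has the same
   ancestors, so it is reachable from [k]. *)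
case: (arg_minnP (fun k => #|anc k|) tail_a) => k /andP [kT].
case/exists_inP => k' k'T kk' k_min.
have [s [sS sk _ s_uniq]] := edge_root kT k'T kk'.
have anc_k x : connect r x k -> tail x -> connect r k x.
  move=> xk /k_min; rewrite /= => le.
  have /eqP eq_anc : anc x == anc k.
    rewrite eqEcard le andbT; apply/subsetP => y; rewrite !inE => yx.
    exact: connect_trans yx xk.
  have : k \in anc x by rewrite eq_anc inE connect0.
  by rewrite inE.
(* Otherwise all in-neighbours of [k] lie in [S], so [s] is the only one. *)
have [y /andP [yT yk]] : exists y, (y \in T) && edge y k.
  case: (pickP (fun y => (y \in T) && edge y k)) => [y yTk|noT]; first by exists y.
  case: (no_unique_in_edge kT sS) => y yY yk.
  have := noT y; rewrite yk andbT inE yY andbT => /negbFE yS.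
  by apply: s_uniq; rewrite ?yk.
have ryk : r y k by rewrite /= yT kT.
have /connectP [p] : connect r k y.
  apply: anc_k; first exact: connect1.
  by rewrite /= yT; apply/exists_inP; exists k.
case/shortenP => {}p p_path p_uniq _ yE.
set c := k :: p in p_uniq.
have c_cycle : cycle r c by rewrite /= rcons_path p_path -yE.
have cT : {subset c <= T}.
  move=> x xc; have := next_cycle c_cycle xc.
  by rewrite /= => /and3P [].
have c_edge : cycle (@edge D) c.
  by apply: sub_cycle c_cycle => u v /and3P [].
have c_out x z : x \in c -> z \in Y -> edge x z -> z \in c.
  exact: cycle_out.
have kc : k \in c by rewrite inE eqxx.
have sT x : x \in T -> (x == s) = false.
  by apply: contraTF => /eqP ->; rewrite inE sS.
(* [edge_root] carries the unique dominating vertex [s] along the edges of the cycle. *)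
have c_in x u : x \in c -> u \in S -> edge u x -> u = s.
  move=> xc; have /connectP [q] := connect_cycle c_cycle kc xc.
  have: edge s k /\ forall u, u \in S -> edge u k -> u = s.
    by split=> // v vS vk; apply: s_uniq; rewrite ?vk.
  elim: q (k) u => [|w q IHq] v u [sv v_uniq] /=; first by move=> _ ->; apply: v_uniq.
  case/andP => /and3P [vT wT vw] q_path xE.
  apply: IHq q_path xE; have [t [tS tv tw t_uniq]] := edge_root vT wT vw.
  have ts := v_uniq t tS tv; rewrite ts in tw t_uniq.
  by split=> // {}u uS uw; apply: t_uniq; rewrite ?uw ?orbT.
pose X := s |: [set x in c].
have XE x : (x \in X) = (x == s) || (x \in c) by rewrite in_setU1 in_set.
have SX : S :&: X = [set s].
  apply/setP => x; rewrite !inE; case: eqVneq => [->|xs] /=; first by rewrite sS.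
  by apply/negP => /andP [xS /cT]; rewrite inE xS.
(* The single vertex [k] suffices as stable set: an in-neighbour of [k] in [T] is reachable from
   [k], hence on the cycle, which no edge leaves. *)
apply: (@split_absurd X [set k] (fun=> s :: c) s).
- by rewrite !inE eqxx.
- apply/subsetP => x; rewrite !inE => /orP [/eqP ->|]; first exact: SY.
  by move/cT/setDP => [].
- by rewrite sub1set !inE eqxx orbT.
- by move=> ? ? /set1P -> /set1P ->; rewrite adjacent_irr.
- move=> _ z /set1P -> zY /orP [kz|zk].
    by rewrite XE (c_out k) ?orbT.
  rewrite XE; case: (boolP (z \in S)) => zS.
    by rewrite (c_in k z) ?eqxx.
  have zT : z \in T by rewrite inE zS.
  have rzk : r z k by rewrite /= zT kT.
  have : connect r k z.
    apply: anc_k; first exact: connect1.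
    by rewrite /= zT; apply/exists_inP; exists k.
  case/connectP => q q_path ->; apply/orP; right.
  elim: q (k) kc q_path => [|w q IHq] v vc //= /andP [/and3P [vT wT vw]].
  by apply: IHq; apply: c_out vw => //; case/setDP: wT.
- by rewrite SX !cards1.
rewrite SX; split=> [t|t|t u|t|z|t u].
- move/set1P => _; rewrite cons_uniq p_uniq andbT.
  by apply/negP => /cT; rewrite inE sS.
- move=> _; rewrite /= sk /=; apply: sub_path p_path.
  by move=> u v /and3P [].
- by move=> /set1P -> /set1P ->; rewrite inE eqxx.
- by move=> _ z; rewrite !inE.
- by rewrite XE => zX; exists s; rewrite ?set11 // in_cons.
by move=> /set1P -> /set1P ->.
Qed.

(** * The bipartite case *)

(** For an edge s -> t with [t] in [T], either [S] without [s] stays maximum after deleting both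
    ends, and the path s -> t completes a partition of the rest; or a larger stable set gives a set
    [C] in [T] with exactly |C| neighbours in [S], and [C] with these neighbours splits off. *)
Lemma counterexample_absurd : False.
Proof.
pose T := Y :\: S.
have nadj t u : t \in T -> u \in T -> adjacent t u = false.
  by move=> tT uT; rewrite /adjacent !T_edgeless.
case: (set_0Vmem T) => [T0|[t tT]].
  apply: (no_orth (f := fun s => [:: s])).
  have YS : {subset Y <= S}.
    by move=> y yY; apply/negPn/negP => yS; have := in_set0 y; rewrite -T0 inE yS yY.
  split=> [//|//|s u _ _|s sS y|y /YS yS|s u _ _ y].
  - by rewrite inE.
  - by rewrite inE => /eqP ->; apply: SY.
  - by exists y; rewrite ?inE.
  - by rewrite !inE => /eqP -> /eqP.
have [s sS st] := in_edge_S tT; have /setDP [tY tS] := tT.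
have S_max' : max_stable_in (Y :\: [set s; t]) (S :\: [set s; t]).
  split.
  - exact/setSD/max_stable_sub.
  - exact: stable_subset (subsetDl _ _) (max_stable_stable S_max).
  move=> Z ZY Z_stable; rewrite leqNgt; apply/negP => ltZ.
  pose C := Z :\: S; pose N := nbrs S C.
  have C_stable : stable C := stable_subset (subsetDl _ _) Z_stable.
  have CT : C \subset T by apply/setSD/(subset_trans ZY)/subsetDl.
  have NS : N \subset S by apply/subsetP => u /nbrsP [].
  have cardCN := card_nbrs S_max CT C_stable.
  (* [Z] has at least |S| elements, and its part in [S] avoids [s] and [N]. *)
  have cardNC : #|s |: N| <= #|C|.
    have ZS : Z :&: S \subset S :\: (s |: N).
      apply/subsetP => u /setIP [uZ uS]; rewrite in_setD uS andbT in_setU1 negb_or.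
      apply/andP; split.
        by have := subsetP ZY u uZ; rewrite !inE negb_or => /andP [/andP []].
      apply/negP => /nbrsP [_ [w /setDP [wZ _] wu]].
      by have := Z_stable w u wZ uZ; rewrite wu.
    have sNS : s |: N \subset S by rewrite subUset sub1set sS.
    have := subset_leq_card ZS; rewrite cardsD (setIidPr sNS).
    move: ltZ; rewrite cardsD (_ : S :&: [set s; t] = [set s]); last first.
      apply/setP => u; rewrite !inE; case: (eqVneq u s) => [->|_] /=; first by rewrite sS.
      by apply/negP => /andP [uS /eqP ut]; rewrite -ut uS in tS.
    rewrite cards1 -(cardsID S Z) subn1 -/C.
    have := subset_leq_card sNS.
    have : 0 < #|S| by rewrite card_gt0; apply/set0Pn; exists s.
    by lia.
  have sN : s \in N.
    apply/negPn/negP => sN; move: cardNC; rewrite cardsU1 sN add1n.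
    by rewrite ltnNge cardCN.
  have {}cardNC : #|N| <= #|C| by rewrite (setUidPr _) ?sub1set in cardNC.
  pose X := C :|: N.
  have CY : C \subset Y := subset_trans CT (subsetDl _ _).
  have XY : X \subset Y by rewrite subUset CY; apply/subsetP => u /(subsetP NS)/SY.
  have SX : S :&: X = N.
    apply/setP => u; rewrite in_setI in_setU in_setD.
    case: (boolP (u \in S)) => //= uS.
    by apply/esym/negbTE; apply: contra uS => /(subsetP NS).
  have N_closed w z : w \in C -> z \in Y -> adjacent w z -> z \in X.
    move=> wC zY wz; rewrite inE; case: (boolP (z \in S)) => zS.
      by apply/orP; right; apply/nbrsP; split=> //; exists w.
    by have := nadj w z (subsetP CT w wC); rewrite wz inE zS zY => /(_ isT).
  have tX : t \notin X.
    rewrite !inE (negPf tS) /= orbF; apply/negP => /(subsetP ZY).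
    by rewrite !inE eqxx orbT.
  have sX : s \in X by rewrite inE sN orbT.
  have X_max : max_stable_in X (S :&: X).
    have /eqP SY0 : S :\: Y == set0 by rewrite setD_eq0 max_stable_sub.
    (* The roles are swapped: the piece removed is [Y :\: X], with stable set [S :\: N], which has
       no neighbours in [C]. *)
    have := @max_stable_split _ Y S (Y :\: X) (S :\: N) S_max.
    rewrite !setDDr setDv set0U (setIidPr XY).
    rewrite SY0 set0U; apply.
    - apply/subsetP => u /setDP [uS uN]; rewrite inE SY // andbT in_setU negb_or uN.
      by rewrite inE uS.
    - exact: subsetDl.
    - exact: stable_subset (subsetDl _ _) (max_stable_stable S_max).
    - move=> w z /setDP [wS wN] zY wz; rewrite inE zY andbT.
      apply/negP => /setUP [zC|/(subsetP NS) zS]; last first.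
        by have := max_stable_stable S_max wS zS; rewrite wz.
      by case/negP: wN; apply/nbrsP; split=> //; exists z; rewrite // adjacentC.
    apply/subset_leq_card/subsetP => u; rewrite !inE => /and3P [uS uX _].
    by move: uX; rewrite negb_or uS => /andP [_ ->].
  have [|f orthf] := IH _ X_max.
    by apply: proper_card; apply/properP; split=> //; exists t.
  apply: (split_absurd sX XY (subsetUl _ _) C_stable N_closed _ orthf).
  by rewrite SX.
have XY : [set s; t] \subset Y by rewrite subUset !sub1set SY.
have stS : S :&: [set s; t] = [set s].
  apply/setP => u; rewrite !inE; case: (eqVneq u s) => [->|_] /=; first by rewrite sS.
  by apply/negP => /andP [uS /eqP ut]; rewrite -ut uS in tS.
have [|g orthg] := IH _ S_max'.
  rewrite cardsD (setIidPr XY) ltn_subrL !card_gt0.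
  by apply/andP; split; apply/set0Pn; [exists s | exists t]; rewrite ?inE ?eqxx.
apply: no_orth (orth_union (f := fun=> [:: s; t]) XY (max_stable_sub S_max) _ orthg).
have s_t := edge_neq st.
rewrite stS; split=> [u _|u _|u v|u _ v|v|u v].
- by rewrite /= inE s_t.
- by rewrite /= st.
- by move=> /set1P -> /set1P ->; rewrite inE eqxx.
- by rewrite !inE.
- by move/set2P => vst; exists s; rewrite ?set11 // !inE; apply/orP; case: vst => ->; rewrite eqxx; [left|right].
by move=> /set1P -> /set1P ->.
Qed.

End MinimalCounterexample.

(** * Induction on [Y] and transfer to induced subdigraphs *)

Lemma alis_orthogonal (D : digraph) (Y S : {set D}) :
  arc_locally_in_semicomplete D -> max_stable_in Y S ->
  exists f, orthogonal S Y f.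
Proof.
move=> D_alis; have [n] := ubnP #|Y|.
elim: n Y S => // n IHn Y S; rewrite ltnS => Y_n S_max.
apply: contrapT => no_orth; apply: (counterexample_absurd D_alis S_max).
  by move=> Y' S' ltY; apply: IHn; apply: leq_trans ltY Y_n.
by move=> f orth; apply: no_orth; exists f.
Qed.

Lemma val_stable (D : digraph) (A : {set D}) (S : {set induced A}) :
  stable S <-> stable (val @: S).
Proof.
split=> S_stable.
  by move=> _ _ /imsetP [x xS ->] /imsetP [y yS ->]; apply: S_stable.
move=> x y xS yS; apply: (S_stable (val x) (val y)); exact: imset_f.
Qed.

Lemma val_max_stable (D : digraph) (A : {set D}) (S : {set induced A}) :
  maximum_stable S -> max_stable_in A (val @: S).
Proof.
case=> S_stable S_max; split.
- by apply/subsetP => _ /imsetP [x _ ->]; apply: valP.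
- exact/val_stable.
move=> Z ZA Z_stable.
have ZE : Z = val @: [set x : induced A | val x \in Z].
  apply/setP => z; apply/idP/imsetP => [zZ|[x]]; last by rewrite inE => xZ ->.
  by exists (Sub z (subsetP ZA z zZ)); rewrite ?inE SubK.
rewrite ZE !card_imset; try exact: val_inj.
by apply/S_max/val_stable; rewrite -ZE.
Qed.

Theorem theorem35 (D : digraph)
    (D_alis : arc_locally_in_semicomplete D)
    (D_no_aoc : forall A : {set D}, ~ antidirected_odd_cycle (induced A)) :
  alpha_diperfect D.
Proof.
move=> A S /val_max_stable /(alis_orthogonal D_alis) [f orth].
have vS s : s \in S -> val s \in val @: S by apply: imset_f.
(* The path is pulled back along [val]; [insub] drops no vertex, as the path lies in [A]. *)
pose F (s : induced A) : seq (induced A) := pmap insub (f (val s)).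
have FE s : s \in S -> map val (F s) = f (val s).
  move=> sS; rewrite /F (pmap_filter (insubK _)); apply/all_filterP/allP => x xs.
  by rewrite isSome_insub; apply: (orth_sub orth (vS _ sS)).
have F_mem s x : s \in S -> (x \in F s) = (val x \in f (val s)).
  by move=> sS; rewrite -FE // mem_map //; apply: val_inj.
exists [seq F s | s <- enum S]; split; [split|].
- move=> _ /mapP [s + ->]; rewrite mem_enum => sS; apply/and3P; split.
  + have : s \in F s by rewrite F_mem // (orth_mem orth) ?vS.
    by case: (F s).
  + by rewrite -(map_inj_uniq val_inj) FE // (orth_uniq orth) ?vS.
  + by have := orth_sorted orth (vS _ sS); rewrite -FE // sorted_map.
- move=> v; have [_ /imsetP [s sS ->] vs] := orth_cover orth (valP v).
  rewrite count_map; apply: (count_eq1_uniq (x := s)); rewrite ?enum_uniq ?mem_enum //.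
  move=> t; rewrite mem_enum => tS /=; rewrite F_mem //.
  apply/idP/eqP => [vt|-> //]; apply: val_inj.
  by apply: (orth_disj orth) vt vs; apply: vS.
move=> _ /mapP [s + ->]; rewrite mem_enum => sS.
rewrite (_ : _ :&: S = [set s]) ?cards1 //.
apply/setP => x; rewrite !inE; case: (boolP (x \in S)) => xS.
  by rewrite andbT F_mem // (orth_mem orth) ?vS // val_eqE.
by rewrite andbF; apply/esym; apply: contraNF xS => /eqP ->.
Qed.
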